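(* In TX10, for all closed statements $s,t$ with $\mathsf{isAsync}(s)$ and $\mathsf{isAsync}(t)$ and every global heap $g$, $\langle\{s\ t\},g\rangle\equiv\langle\{t\ s\},g\rangle$, where $\equiv$ is weak bisimilarity.
   Context: **Syntax.** $\mathsf{Pl}=\{0,\dots,n-1\}$ is a finite set of places (ranged over by $p,q$). $\mathsf{ObjId}$ is an infinite set of object ids with a fixed bijection with $\mathbb N$ (the enumeration order); $\mathsf p:\mathsf{ObjId}\to\mathsf{Pl}$ gives the home place; $\mathsf{ObjId}_q=\{o:\mathsf p(o)=q\}$; global references are $\mathsf{grObjId}=\{o\$p : o\in\mathsf{ObjId}_p\}$. Values $v$: object ids $o$, global references $o\$p$, exception constants $\mathsf E,\mathsf{BF},\mathsf{BG},\mathsf{DP}$. Expressions: $e::= v\mid x\mid e.f\mid\{f_1{:}e_1,\dots,f_n{:}e_n\}\mid \mathtt{globalref}\ e\mid\mathtt{valof}\ e$. Statements: $s,t::=\mathtt{skip}\mid\mathtt{throw}\ v$ ($v$ an exception constant) $\mid \mathtt{val}\ x=e\ s\mid e.f=e'\mid\{s\ t\}\mid\mathtt{at}(p)(\mathtt{val}\ x=e)\,s\mid\mathtt{async}\ s\mid\mathtt{finish}\ s\mid\mathtt{try}\ s\ \mathtt{catch}\ t$, plus the dynamic (runtime only) statements $\overline{\mathtt{at}}(p)\,s\mid\overline{\mathtt{async}}\,s\mid\mathtt{finish}_\mu\,s$ with $\mu$ a finite set of exception values; $\mathtt{finish}\ s$ abbreviates $\mathtt{finish}_\emptyset\,s$.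 In $\mathtt{val}\ x=e\ s$ and $\mathtt{at}(p)(\mathtt{val}\ x=e)s$ the only free variable of $s$ is $x$. A configuration is closed if its statement has no free variables. **Heaps.** A local heap $h$ is a finite partial map from object ids to objects, an object being a finite partial map from field names to values. In TX10 a global heap $g$ maps every place of $\mathsf{Pl}$ to a local heap. $f[a\mapsto b]$ denotes map update. For $o\in\mathrm{dom}(h)$, $h_o$ is the set of object ids (local or global) reachable from $o$ in $h$ via fields. $g$ is place-local if for every $q\in\mathrm{dom}(g)$, with $h=g(q)$: $\mathrm{dom}(h)\subseteq\mathsf{ObjId}_q$ and $h_o\subseteq(\mathsf{ObjId}_q\cap\mathrm{dom}(h))\cup\mathsf{grObjId}$ for all $o\in\mathrm{dom}(h)$. **Predicates.** $\mathsf{isAsync}(\overline{\mathtt{async}}\,s)$; $\mathsf{isAsync}(s)$ implies $\mathsf{isAsync}(\overline{\mathtt{at}}(p)s)$ and $\mathsf{isAsync}(\mathtt{try}\,s\,\mathtt{catch}\,t)$; $\mathsf{isAsync}(s)$ and $\mathsf{isAsync}(t)$ imply $\mathsf{isAsync}(\{s\ t\})$. $\mathsf{isSync}$ holds of $\mathtt{skip}$, $\mathtt{val}\ x=e\ s$, $e.f=e'$, $\mathtt{at}(p)(\mathtt{val}\ x=e)s$, $\mathtt{async}\ s$, $\mathtt{finish}_\mu\,s$, $\mathtt{throw}\ v$; and $\mathsf{isSync}(s)$ implies $\mathsf{isSync}$ of $\{s\ t\}$, $\{t\ s\}$, $\overline{\mathtt{at}}(p)s$, $\mathtt{try}\,s\,\mathtt{catch}\,t$.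 **Transitions.** Configurations $k$ are $\langle s,g\rangle$ or $g$ (terminated). Labels $\lambda$: $\epsilon$ (normal), $v\otimes$ (synchronous exception), $v\times$ (asynchronous exception). $\to_p$ means $\xrightarrow{\epsilon}_p$. In rules, ''$A\mid B$'' in premise and conclusion denotes two rules, matching first with first and second with second. *Expressions* (at place $p$, local heap $h$): $\langle\{f_1{:}v_1,\dots,f_n{:}v_n\},h\rangle\to_p\langle o,h[o\mapsto\{f_i\mapsto v_i\}]\rangle$ with $o\in\mathsf{ObjId}_p\setminus\mathrm{dom}(h)$; $\langle o.f,h\rangle\to_p\langle v,h\rangle$ if $h(o)(f)=v$; $\langle o.f,h\rangle\xrightarrow{\mathsf{BF}\otimes}_p h$ if $f\notin\mathrm{dom}(h(o))$; $\langle\mathtt{globalref}\ o,h\rangle\to_p\langle o\$p,h\rangle$; $\langle\mathtt{valof}\ o\$p,h\rangle\to_p\langle o,h\rangle$; $\langle\mathtt{valof}\ v,h\rangle\xrightarrow{\mathsf{BG}\otimes}_p h$ if $v$ is not of the form $o\$p$; and if $\langle e,h\rangle\xrightarrow{\lambda}_p\langle e',h'\rangle\mid h$ then the same label is taken in the contexts $[\,].f$, $\mathtt{globalref}\,[\,]$, $\mathtt{valof}\,[\,]$, $\{f_1{:}v_1,\dots,f_i{:}v_i,f_{i+1}{:}[\,],\dots\}$ (leading to $h$ in the exceptional case). *Basic statements* (all require $p\in\mathrm{dom}(g)$): $\langle\mathtt{skip},g\rangle\to_p g$; $\langle\mathtt{throw}\ v,g\rangle\xrightarrow{v\otimes}_p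 g$; if $\langle s[v/x],g\rangle\xrightarrow{\lambda}_p\langle s',g'\rangle\mid g'$ then $\langle\mathtt{val}\ x=v\ s,g\rangle\xrightarrow{\lambda}_p\langle s',g'\rangle\mid g'$; $\langle o.f=v,g\rangle\to_p g[p\mapsto g(p)[o\mapsto g(p)(o)[f\mapsto v]]]$ if $f\in\mathrm{dom}(g(p)(o))$; $\langle o.f=v,g\rangle\xrightarrow{\mathsf{BF}\otimes}_p g$ if $f\notin\mathrm{dom}(g(p)(o))$; (Ctx) if $\langle e,g(p)\rangle\xrightarrow{\lambda}_p\langle e',h'\rangle\mid h'$ and $g'=g[p\mapsto h']$ then $\mathtt{val}\ x=e\ s$, $e.f=e_1$, $o.f=e$, $\mathtt{at}(q)(\mathtt{val}\ x=e)s$ in heap $g$ make a $\lambda$-step at $p$ to the same statement with $e'$ for $e$ in heap $g'$, resp. to $g'$. *Copy.* For $o\in\mathsf{ObjId}$ and $q\in\mathrm{dom}(g)$, $\mathsf{copy}(o,q,g)=(o',g[q\mapsto h'])$ where $h'$ extends $h=g(q)$ by a fresh isomorphic copy, rooted at $o'$, of the object graph reachable from $o$ in $g(\mathsf p(o))$; the new ids are the next unused elements of $\mathsf{ObjId}_q$ and global references are preserved unchanged. For other values $\mathsf{copy}(v,q,g)=(v,g)$. *Remaining TX10 rules:* (Spawn) $\langle\mathtt{async}\ s,g\rangle\to_p\langle\overline{\mathtt{async}}\,s,g\rangle$. (Async) if $\langle s,g\rangle\xrightarrow{\lambda}_p\langle s',g'\rangle\mid g'$ then $\langle\overline{\mathtt{async}}\,s,g\rangle\xrightarrow{\lambda'}_p\langle\overline{\mathtt{async}}\,s',g'\rangle\mid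 g'$, with $\lambda'=\epsilon$ if $\lambda=\epsilon$ and $\lambda'=v\times$ if $\lambda\in\{v\times,v\otimes\}$. (Finish) if $\langle s,g\rangle\xrightarrow{\lambda}_p\langle s',g'\rangle$ then $\langle\mathtt{finish}_\mu s,g\rangle\to_p\langle\mathtt{finish}_{\mu\cup\lambda}s',g'\rangle$, where $\mu\cup\epsilon=\mu$ and $\mu\cup v\times=\mu\cup v\otimes=\mu\cup\{v\}$. (End of Finish) if $\langle s,g\rangle\xrightarrow{\lambda}_p g'$ then $\langle\mathtt{finish}_\mu s,g\rangle\xrightarrow{\lambda'}_p g'$ with $\lambda'=\epsilon$ if $\mu\cup\lambda=\emptyset$, else $\lambda'=\mathsf E\otimes$. (Seq) if $\langle s,g\rangle\xrightarrow{\lambda}_p\langle s',g'\rangle\mid g'$: if $\lambda\in\{\epsilon,v\times\}$, $\langle\{s\ t\},g\rangle\xrightarrow{\lambda}_p\langle\{s'\ t\},g'\rangle\mid\langle t,g'\rangle$; if $\lambda=v\otimes$, $\langle\{s\ t\},g\rangle\xrightarrow{\lambda}_p\langle s',g'\rangle\mid g'$. (Par) if $\mathsf{isAsync}(t)$ and $\langle s,g\rangle\xrightarrow{\lambda}_p\langle s',g'\rangle\mid g'$ then $\langle\{t\ s\},g\rangle\xrightarrow{\lambda}_p\langle\{t\ s'\},g'\rangle\mid\langle t,g'\rangle$. (Place Shift) if $(v',g')=\mathsf{copy}(v,q,g)$ then $\langle\mathtt{at}(q)(\mathtt{val}\ x=v)s,g\rangle\to_p\langle\overline{\mathtt{at}}(q)\{s[v'/x]\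 \mathtt{skip}\},g'\rangle$. (At) if $\langle s,g\rangle\xrightarrow{\lambda}_q\langle s',g'\rangle\mid g'$ then $\langle\overline{\mathtt{at}}(q)s,g\rangle\xrightarrow{\lambda}_p\langle\overline{\mathtt{at}}(q)s',g'\rangle\mid g'$. (Try) if $\langle s,g\rangle\xrightarrow{\lambda}_p\langle s',g'\rangle\mid g'$: if $\lambda\in\{\epsilon,v\times\}$, $\langle\mathtt{try}\,s\,\mathtt{catch}\,t,g\rangle\xrightarrow{\lambda}_p\langle\mathtt{try}\,s'\,\mathtt{catch}\,t,g'\rangle\mid g'$; if $\lambda=v\otimes$, $\langle\mathtt{try}\,s\,\mathtt{catch}\,t,g\rangle\to_p\langle\{s'\ t\},g'\rangle\mid\langle t,g'\rangle$. **Weak bisimulation.** An environment move is a map $\Phi$ on global heaps such that $\Phi(g)$ is place-local whenever $g$ is, $\mathrm{dom}(\Phi(g))=\mathrm{dom}(g)$, and $\mathrm{dom}(g(p))\subseteq\mathrm{dom}(\Phi(g)(p))$ for all $p\in\mathrm{dom}(g)$. $\overset{\lambda}{\Longrightarrow}_p$ is $(\to_p)^*\xrightarrow{\lambda}_p(\to_p)^*$ if $\lambda\neq\epsilon$, and $(\to_p)^*$ if $\lambda=\epsilon$. A binary relation $\mathcal R$ on closed configurations is a weak bisimulation if: (1) $g\,\mathcal R\,k$ implies $k=g$; (2) $\langle s,g\rangle\,\mathcal R\,k$ implies $k=\langle t,g\rangle$ for some $t$, $\mathsf{isSync}(s)$ iff $\mathsf{isSync}(t)$, and for every environment move $\Phi$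 and every place $p$: (a) if $\langle s,\Phi(g)\rangle\xrightarrow{\lambda}_p\langle s',g'\rangle$ then for some $t'$, $\langle t,\Phi(g)\rangle\overset{\lambda}{\Longrightarrow}_p\langle t',g'\rangle$ and $\langle s',g'\rangle\,\mathcal R\,\langle t',g'\rangle$, and vice versa; (b) if $\langle s,\Phi(g)\rangle\xrightarrow{\lambda}_p g'$ then $\langle t,\Phi(g)\rangle\overset{\lambda}{\Longrightarrow}_p g'$, and vice versa. Weak bisimilarity $\equiv$ is the largest weak bisimulation. *)

(* Defs.v *)
From HB Require Import structures.
From mathcomp Require Import all_boot finmap.
From Stdlib Require Import Relation_Operators.

Set Implicit Arguments.
Unset Strict Implicit.
Unset Printing Implicit Defensive.

Local Open Scope fset_scope.
Local Open Scope fmap_scope.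

(* Object ids are identified with their rank in the enumeration order.        *)
Definition objId := nat.
Definition field := nat.
Definition var := nat.

Inductive exn := E | BF | BG | DP.

Definition exn_code (v : exn) : bool * bool :=
  match v with
  | E => (false, false) | BF => (false, true)
  | BG => (true, false) | DP => (true, true)
  end.
Definition exn_decode (c : bool * bool) : exn :=
  match c with
  | (false, false) => E | (false, true) => BF
  | (true, false) => BG | (true, true) => DP
  end.
Lemma exn_codeK : cancel exn_code exn_decode.
Proof. by case. Qed.
HB.instance Definition _ := Finite.copy exn (can_type exn_codeK).

(* A global reference o$p only exists for p the home place of o, so that p is *)
(* redundant: [VGref o] is o$(home o).                                        *)
Inductive value :=
  | VObj of objId
  | VGref of objId
  | VExn of exn.

Inductive expr :=
  | EVal of value
  | EVar of var
  | EField of expr & field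
  | ERec of seq (field * expr)
  | EGlobalref of expr
  | EValof of expr.

Inductive stmt (n : nat) :=
  | Skip
  | Throw of exn
  | Val of var & expr & stmt n
  | Assign of expr & field & expr
  | Seq of stmt n & stmt n
  | At of 'I_n & var & expr & stmt n    (* at(p)(val x = e) s *)
  | Async of stmt n
  | Try of stmt n & stmt n
  | DynAt of 'I_n & stmt n              (* overlined at *)
  | DynAsync of stmt n                  (* overlined async *)
  | Finish of {set exn} & stmt n.       (* finish_mu s; finish s is [Finish set0 s] *)

Arguments Skip {n}.
Arguments Throw {n} _.
Arguments Assign {n} _ _ _.

Definition object := {fmap field -> value}.
Definition heap := {fmap objId -> object}.
Definition gheap (n : nat) := {ffun 'I_n -> heap}.

Definition upd n (g : gheap n) (p : 'I_n) (h : heap) : gheap n :=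
  [ffun q => if q == p then h else g q].

Fixpoint efv (e : expr) : seq var :=
  match e with
  | EVal _ => [::]
  | EVar x => [:: x]
  | EField e _ => efv e
  | ERec fs => flatten [seq efv fe.2 | fe <- fs]
  | EGlobalref e => efv e
  | EValof e => efv e
  end.

Fixpoint sfv n (s : stmt n) : seq var :=
  match s with
  | Skip => [::]
  | Throw _ => [::]
  | Val x e s => efv e ++ [seq y <- sfv s | y != x]
  | Assign e _ e' => efv e ++ efv e'
  | Seq s t => sfv s ++ sfv t
  | At _ x e s => efv e ++ [seq y <- sfv s | y != x]
  | Async s => sfv s
  | Try s t => sfv s ++ sfv t
  | DynAt _ s => sfv s
  | DynAsync s => sfv s
  | Finish _ s => sfv s
  end.

(* The side condition of the grammar: the body of a val or of an at has no    *)
(* free variable besides the one that is bound there.                         *)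
Fixpoint scoped n (s : stmt n) : bool :=
  match s with
  | Skip => true
  | Throw _ => true
  | Val x _ s => scoped s && all (pred1 x) (sfv s)
  | Assign _ _ _ => true
  | Seq s t => scoped s && scoped t
  | At _ x _ s => scoped s && all (pred1 x) (sfv s)
  | Async s => scoped s
  | Try s t => scoped s && scoped t
  | DynAt _ s => scoped s
  | DynAsync s => scoped s
  | Finish _ s => scoped s
  end.

Definition closed_stmt n (s : stmt n) : bool := scoped s && nilp (sfv s).

Fixpoint esubst (x : var) (v : value) (e : expr) : expr :=
  match e with
  | EVal w => EVal w
  | EVar y => if y == x then EVal v else EVar y
  | EField e f => EField (esubst x v e) f
  | ERec fs => ERec [seq (fe.1, esubst x v fe.2) | fe <- fs]
  | EGlobalref e => EGlobalref (esubst x v e)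
  | EValof e => EValof (esubst x v e)
  end.

Fixpoint ssubst n (x : var) (v : value) (s : stmt n) : stmt n :=
  match s with
  | Skip => Skip
  | Throw w => Throw w
  | Val y e s => Val y (esubst x v e) (if y == x then s else ssubst x v s)
  | Assign e f e' => Assign (esubst x v e) f (esubst x v e')
  | Seq s t => Seq (ssubst x v s) (ssubst x v t)
  | At q y e s => At q y (esubst x v e) (if y == x then s else ssubst x v s)
  | Async s => Async (ssubst x v s)
  | Try s t => Try (ssubst x v s) (ssubst x v t)
  | DynAt q s => DynAt q (ssubst x v s)
  | DynAsync s => DynAsync (ssubst x v s)
  | Finish mu s => Finish mu (ssubst x v s)
  end.

Fixpoint isAsync n (s : stmt n) : bool :=
  match s with
  | DynAsync _ => true
  | DynAt _ s => isAsync s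
  | Try s _ => isAsync s
  | Seq s t => isAsync s && isAsync t
  | _ => false
  end.

Fixpoint isSync n (s : stmt n) : bool :=
  match s with
  | Skip | Throw _ | Val _ _ _ | Assign _ _ _ | At _ _ _ _ | Async _
  | Finish _ _ => true
  | Seq s t => isSync s || isSync t
  | DynAt _ s => isSync s
  | Try s _ => isSync s
  | DynAsync _ => false
  end.

Inductive label :=
  | Eps
  | SyncExn of exn       (* v \otimes *)
  | AsyncExn of exn.     (* v \times *)

Definition async_label (l : label) : label :=
  match l with Eps => Eps | SyncExn v | AsyncExn v => AsyncExn v end.

Definition add_label (mu : {set exn}) (l : label) : {set exn} :=
  match l with Eps => mu | SyncExn v | AsyncExn v => (v |: mu)%SET end.

Definition finish_label (mu : {set exn}) : label :=
  if mu == set0 then Eps else SyncExn E.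

Definition is_syncexn (l : label) : bool :=
  if l is SyncExn _ then true else false.

(* Used for expressions over a local heap and for statements over a global one. *)
Inductive conf (T H : Type) :=
  | Run of T & H
  | Done of H.
Arguments Run {T H} _ _.
Arguments Done {T H} _.

Definition sconf (n : nat) := conf (stmt n) (gheap n).

(* [plug C k] and [andthen C t k] render the right-hand sides                 *)
(* < C[s'], g' > | g'  and  < C[s'], g' > | < t, g' > of the double rules.    *)
Definition plug T U H (C : T -> U) (k : conf T H) : conf U H :=
  match k with Run s h => Run (C s) h | Done h => Done h end.

Definition andthen T U H (C : T -> U) (t : U) (k : conf T H) : conf U H :=
  match k with Run s h => Run (C s) h | Done h => Run t h end.

Definition in_place n T (C : T -> stmt n) (g : gheap n) (p : 'I_n)
    (k : conf T heap) : sconf n :=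
  match k with
  | Run e h => Run (C e) (upd g p h)
  | Done h => Done (upd g p h)
  end.

Definition closed_conf n (k : sconf n) : bool :=
  match k with Run s _ => closed_stmt s | Done _ => true end.

(* [reach h o v] : v is reachable from o in h via fields; the ids among these *)
(* values form the set h_o. The path stops at ids outside the domain of h and *)
(* at global references.                                                      *)
Inductive reach (h : heap) (o : objId) : value -> Prop :=
  | reach_refl : reach h o (VObj o)
  | reach_field o1 (ob : object) f v :
      reach h o (VObj o1) -> h.[? o1] = Some ob -> ob.[? f] = Some v ->
      reach h o v.

(* A repeated field name keeps its last value.                                *)
Definition mkobject (fvs : seq (field * value)) : object :=
  foldl (fun (ob : object) fv => ob.[fv.1 <- fv.2]) [fmap] fvs.

Definition lit (fvs : seq (field * value)) : seq (field * expr) :=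
  [seq (fv.1, EVal fv.2) | fv <- fvs].

Definition rename_val (r : objId -> objId) (v : value) : value :=
  if v is VObj o then VObj (r o) else v.

Definition rename_obj (r : objId -> objId) (ob : object) : object :=
  [fmap f : domf ob => rename_val r (ob f)].

Section Semantics.

Variables (n : nat) (home : objId -> 'I_n).

Definition place_local (g : gheap n) : Prop :=
  forall q o, o \in domf (g q) ->
    home o = q /\
    forall v, reach (g q) o v ->
      match v with
      | VObj o' => home o' = q /\ o' \in domf (g q)
      | VGref _ => True
      | VExn _ => True
      end.

Definition unused (q : 'I_n) (h : heap) (o : objId) : Prop :=
  home o = q /\ o \notin domf h.

(* [copy_obj o q g o' g'] : copy(o, q, g) = (o', g'). The nodes of the graph  *)
(* of o are mapped by r, in increasing order, onto the first unused ids of    *)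
(* place q; r is thereby determined on these nodes. A dangling node (there is *)
(* none if g is place-local) has a dangling copy.                             *)
Definition copy_obj (o : objId) (q : 'I_n) (g : gheap n)
    (o' : objId) (g' : gheap n) : Prop :=
  let src := g (home o) in
  let node o1 := reach src o (VObj o1) in
  exists (r : objId -> objId) (h' : heap),
    [/\ forall o1, node o1 -> unused q (g q) (r o1),
        forall o1 x, node o1 -> unused q (g q) x -> (x < r o1)%N ->
          exists2 o2, node o2 & r o2 = x,
        forall o1 o2, node o1 -> node o2 -> (o1 < o2)%N -> (r o1 < r o2)%N,
        [/\ forall x, x \in domf (g q) -> h'.[? x] = (g q).[? x],
            forall o1, node o1 ->
              h'.[? r o1] = omap (rename_obj r) src.[? o1] &
            forall x, x \notin domf (g q) -> (forall o1, node o1 -> x <> r o1) ->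
              h'.[? x] = None]
      & o' = r o /\ g' = upd g q h'].

Definition copy (v : value) (q : 'I_n) (g : gheap n)
    (v' : value) (g' : gheap n) : Prop :=
  match v with
  | VObj o => exists2 o', v' = VObj o' & copy_obj o q g o' g'
  | _ => v' = v /\ g' = g
  end.

Implicit Types (p q : 'I_n) (h : heap) (g : gheap n) (o : objId) (f : field).
Implicit Types (v : value) (e : expr) (s t : stmt n) (l : label).

Inductive estep p : conf expr heap -> label -> conf expr heap -> Prop :=
  | e_new fvs h o :
      home o = p -> o \notin domf h ->
      estep p (Run (ERec (lit fvs)) h) Eps
              (Run (EVal (VObj o)) h.[o <- mkobject fvs])
  | e_select o f h (ob : object) v :
      h.[? o] = Some ob -> ob.[? f] = Some v ->
      estep p (Run (EField (EVal (VObj o)) f) h) Eps (Run (EVal v) h)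
  | e_select_bad o f h (ob : object) :
      h.[? o] = Some ob -> f \notin domf ob ->
      estep p (Run (EField (EVal (VObj o)) f) h) (SyncExn BF) (Done h)
  | e_globalref o h :
      home o = p ->
      estep p (Run (EGlobalref (EVal (VObj o))) h) Eps (Run (EVal (VGref o)) h)
  | e_valof o h :
      home o = p ->
      estep p (Run (EValof (EVal (VGref o))) h) Eps (Run (EVal (VObj o)) h)
  | e_valof_bad v h :
      (forall o, home o = p -> v <> VGref o) ->
      estep p (Run (EValof (EVal v)) h) (SyncExn BG) (Done h)
  | e_ctx_field e h l k f :
      estep p (Run e h) l k ->
      estep p (Run (EField e f) h) l (plug (EField ^~ f) k)
  | e_ctx_globalref e h l k :
      estep p (Run e h) l k ->
      estep p (Run (EGlobalref e) h) l (plug EGlobalref k)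
  | e_ctx_valof e h l k :
      estep p (Run e h) l k ->
      estep p (Run (EValof e) h) l (plug EValof k)
  | e_ctx_rec fvs f e fes h l k :
      estep p (Run e h) l k ->
      estep p (Run (ERec (lit fvs ++ (f, e) :: fes)) h) l
              (plug (fun e' => ERec (lit fvs ++ (f, e') :: fes)) k).

(* A global heap is total on places, so the premises p \in dom(g) are void.   *)
Inductive step : 'I_n -> sconf n -> label -> sconf n -> Prop :=
  | s_skip p g :
      step p (Run Skip g) Eps (Done g)
  | s_throw p (v : exn) g :
      step p (Run (Throw v) g) (SyncExn v) (Done g)
  | s_val p x v s g l k :
      step p (Run (ssubst x v s) g) l k ->
      step p (Run (Val x (EVal v) s) g) l k
  | s_assign p o f v g (ob : object) :
      (g p).[? o] = Some ob -> f \in domf ob ->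
      step p (Run (Assign (EVal (VObj o)) f (EVal v)) g) Eps
             (Done (upd g p (g p).[o <- ob.[f <- v]]))
  | s_assign_bad p o f v g (ob : object) :
      (g p).[? o] = Some ob -> f \notin domf ob ->
      step p (Run (Assign (EVal (VObj o)) f (EVal v)) g) (SyncExn BF) (Done g)
  | s_ctx_val p x e s g l k :
      estep p (Run e (g p)) l k ->
      step p (Run (Val x e s) g) l (in_place (fun e' => Val x e' s) g p k)
  | s_ctx_assign1 p e f e1 g l k :
      estep p (Run e (g p)) l k ->
      step p (Run (Assign e f e1) g) l (in_place (fun e' => Assign e' f e1) g p k)
  | s_ctx_assign2 p o f e g l k :
      estep p (Run e (g p)) l k ->
      step p (Run (Assign (EVal (VObj o)) f e) g) l
             (in_place (Assign (EVal (VObj o)) f) g p k)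
  | s_ctx_at p q x e s g l k :
      estep p (Run e (g p)) l k ->
      step p (Run (At q x e s) g) l (in_place (fun e' => At q x e' s) g p k)
  | s_spawn p s g :
      step p (Run (Async s) g) Eps (Run (DynAsync s) g)
  | s_async p s g l k :
      step p (Run s g) l k ->
      step p (Run (DynAsync s) g) (async_label l) (plug (@DynAsync n) k)
  | s_finish p mu s g l s' g' :
      step p (Run s g) l (Run s' g') ->
      step p (Run (Finish mu s) g) Eps (Run (Finish (add_label mu l) s') g')
  | s_end_finish p mu s g l g' :
      step p (Run s g) l (Done g') ->
      step p (Run (Finish mu s) g) (finish_label (add_label mu l)) (Done g')
  | s_seq p s t g l k :
      step p (Run s g) l k -> ~~ is_syncexn l ->
      step p (Run (Seq s t) g) l (andthen (fun s' => Seq s' t) t k)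
  | s_seq_exn p s t g l k :
      step p (Run s g) l k -> is_syncexn l ->
      step p (Run (Seq s t) g) l k
  | s_par p s t g l k :
      isAsync t -> step p (Run s g) l k ->
      step p (Run (Seq t s) g) l (andthen (Seq t) t k)
  | s_place_shift p q x v s g v' g' :
      copy v q g v' g' ->
      step p (Run (At q x (EVal v) s) g) Eps
             (Run (DynAt q (Seq (ssubst x v' s) Skip)) g')
  | s_at p q s g l k :
      step q (Run s g) l k ->
      step p (Run (DynAt q s) g) l (plug (DynAt q) k)
  | s_try p s t g l k :
      step p (Run s g) l k -> ~~ is_syncexn l ->
      step p (Run (Try s t) g) l (plug (fun s' => Try s' t) k)
  | s_try_exn p s t g l k :
      step p (Run s g) l k -> is_syncexn l ->
      step p (Run (Try s t) g) Eps (andthen (fun s' => Seq s' t) t k).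

Definition eps_star p : sconf n -> sconf n -> Prop :=
  clos_refl_trans _ (fun k k' => step p k Eps k').

Definition wstep p (k : sconf n) l (k' : sconf n) : Prop :=
  if l is Eps then eps_star p k k'
  else exists k1 k2, [/\ eps_star p k k1, step p k1 l k2 & eps_star p k2 k'].

(* The condition dom(Phi(g)) = dom(g) is void as global heaps are total.      *)
Definition env_move (Phi : gheap n -> gheap n) : Prop :=
  forall g, (place_local g -> place_local (Phi g)) /\
            (forall p, domf (g p) `<=` domf (Phi g p)).

Definition weak_bisimulation (R : sconf n -> sconf n -> Prop) : Prop :=
  [/\ forall k k', R k k' -> closed_conf k /\ closed_conf k',
      forall g k, R (Done g) k -> k = Done g
    & forall s g k, R (Run s g) k ->
      exists t, [/\ k = Run t g, isSync s <-> isSync t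
        & forall Phi p, env_move Phi ->
          [/\ forall l s' g', step p (Run s (Phi g)) l (Run s' g') ->
                exists t', wstep p (Run t (Phi g)) l (Run t' g') /\
                           R (Run s' g') (Run t' g'),
              forall l t' g', step p (Run t (Phi g)) l (Run t' g') ->
                exists s', wstep p (Run s (Phi g)) l (Run s' g') /\
                           R (Run s' g') (Run t' g'),
              forall l g', step p (Run s (Phi g)) l (Done g') ->
                wstep p (Run t (Phi g)) l (Done g')
            & forall l g', step p (Run t (Phi g)) l (Done g') ->
                wstep p (Run s (Phi g)) l (Done g')]]].

Definition weakly_bisimilar (k k' : sconf n) : Prop :=
  exists2 R, weak_bisimulation R & R k k'.

Lemma weakly_bisimilar_largest :
  weak_bisimulation weakly_bisimilar /\
  forall R, weak_bisimulation R -> forall k k', R k k' -> weakly_bisimilar k k'.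
Proof.
split; last by move=> R wbR k k' Rkk'; exists R.
split=> [k k' [R [clR _ _] /clR] //|g k [R [_ dR _] /dR] //|].
move=> s g k [R wbR Rsk]; have [_ _ rR] := wbR.
have [t [-> sync_st bis]] := rR _ _ _ Rsk; exists t; split=> // Phi p envPhi.
have [b1 b2 b3 b4] := bis Phi p envPhi; split=> // l u g' st.
- by have [t' [wt Rt]] := b1 _ _ _ st; exists t'; split=> //; exists R.
- by have [s' [ws Rs]] := b2 _ _ _ st; exists s'; split=> //; exists R.
Qed.

End Semantics.

(* Main.v *)
Require Import Defs.
From mathcomp Require Import all_boot.
From Stdlib Require Import Relation_Operators.

(** An asynchronous statement never emits a synchronous exception and stays
    asynchronous until it terminates, so each step of [{s t}] is matched by one
    step of [{t s}], rule (Seq) answering rule (Par) and conversely. Once one of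
    the two components terminates both sides are literally equal. *)

Set Implicit Arguments.
Unset Strict Implicit.
Unset Printing Implicit Defensive.

(* [expr] is nested in [seq], so [expr_ind] has no induction hypothesis for the
   fields of a record. *)
Lemma efv_esubst x v (e : expr) :
  efv (esubst x v e) = [seq y <- efv e | y != x].
Proof.
move: e; fix IH 1; case=> //=.
- by move=> y; case: eqP.
- elim=> [//|[f e] fs IHfs] /=; rewrite filter_cat -IHfs.
  by congr (_ ++ _); apply: IH.
Qed.

Lemma nilp_filter_predC1 (T : eqType) (x : T) (r : seq T) :
  nilp [seq y <- r | y != x] = all (pred1 x) r.
Proof. by elim: r => //= y r IHr; case: eqP. Qed.

Section Steps.

Variables (n : nat) (home : objId -> 'I_n).
Implicit Types (s t : stmt n) (k : sconf n) (g : gheap n).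

Lemma sfv_ssubst x v s : sfv (ssubst x v s) = [seq y <- sfv s | y != x].
Proof.
elim: s => //=.
(* If the binder is [x] itself, the body is left alone and its free variables already lack [x], so
   the second filter is idempotent; otherwise the filters by [x] and by [y] commute. *)
- move=> y e s IHs; rewrite filter_cat efv_esubst; case: eqP => [->|_].
    by rewrite filter_id.
  by rewrite IHs -!filter_predI; congr (_ ++ _); apply: eq_filter => z /=; rewrite andbC.
- by move=> e f e'; rewrite filter_cat !efv_esubst.
- by move=> s -> t ->; rewrite filter_cat.
- move=> q y e s IHs; rewrite filter_cat efv_esubst; case: eqP => [->|_].
    by rewrite filter_id.
  by rewrite IHs -!filter_predI; congr (_ ++ _); apply: eq_filter => z /=; rewrite andbC.
- by move=> s -> t ->; rewrite filter_cat.
Qed.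

Lemma scoped_ssubst x v s : scoped s -> scoped (ssubst x v s).
Proof.
have sub y (r : seq var) : all (pred1 y) r -> all (pred1 y) [seq z <- r | z != x].
  by rewrite all_filter; apply: sub_all => z /= ->; rewrite implybT.
elim: s => //=.
- by move=> y e s IHs /andP[cs fs]; case: eqP => _;
    rewrite ?sfv_ssubst ?sub ?IHs ?cs.
- by move=> s IHs t IHt /andP[/IHs-> /IHt->].
- by move=> q y e s IHs /andP[cs fs]; case: eqP => _;
    rewrite ?sfv_ssubst ?sub ?IHs ?cs.
- by move=> s IHs t IHt /andP[/IHs-> /IHt->].
Qed.

(** The premise on [sfv s] is the grammar's side condition on bodies of [Val] and [At]. It ensures
    that substituting for the bound variable leaves none free, which the [s_val] and [s_place_shift]
    cases of [closed_step] rely on. *)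
Lemma closed_ssubst x v s :
  scoped s -> all (pred1 x) (sfv s) -> closed_stmt (ssubst x v s).
Proof.
by move=> cs fs; rewrite /closed_stmt scoped_ssubst // sfv_ssubst nilp_filter_predC1.
Qed.

Lemma closed_Seq s t : closed_stmt (Seq s t) = closed_stmt s && closed_stmt t.
Proof. by rewrite /closed_stmt /= cat_nilp andbACA. Qed.

Lemma closed_Try s t : closed_stmt (Try s t) = closed_stmt s && closed_stmt t.
(* [scoped] and [sfv] compute to the same terms on [Try] and on [Seq]. *)
Proof. exact: closed_Seq. Qed.

Lemma closed_plug (C : stmt n -> stmt n) k :
  (forall s, closed_stmt s -> closed_stmt (C s)) ->
  closed_conf k -> closed_conf (plug C k).
Proof. by case: k => //= s g; apply. Qed.

Lemma closed_andthen (C : stmt n -> stmt n) t k :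
  (forall s, closed_stmt s -> closed_stmt (C s)) -> closed_stmt t ->
  closed_conf k -> closed_conf (andthen C t k).
Proof. by case: k => //= s g; auto. Qed.

(** Closedness is read off by matching on whole configurations, so that the indices of [estep]
    remain variables for the induction. *)
Lemma closed_estep p ke l ke' :
  estep home p ke l ke' ->
  (if ke is Run e _ then nilp (efv e) else true) ->
  if ke' is Run e _ then nilp (efv e) else true.
Proof.
elim=> {ke l ke'} //=.
- by move=> e h l' [].
- by move=> e h l' [].
- by move=> e h l' [].
- move=> fvs f e fes h l' [e' h'|h'] _ IH //=.
  by rewrite !map_cat !flatten_cat /= !cat_nilp => /and3P[-> /IH-> ->].
Qed.

(** A weak bisimulation may relate closed configurations only, so every reduct put into the relation
    must be shown closed. *)
Lemma closed_step p k l k' :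
  step home p k l k' -> closed_conf k -> closed_conf k'.
Proof.
elim=> {p k l k'} //=.
- move=> p x v s g l k _ IH /andP[/andP[cs fs] _]; apply: IH; exact: closed_ssubst.
- move=> p x e s g l [e' h|h] /closed_estep//= H.
  by rewrite /closed_stmt /= !cat_nilp => /and3P[-> /H-> ->].
- move=> p e f e1 g l [e' h|h] /closed_estep//= H.
  by rewrite /closed_stmt /= !cat_nilp => /andP[/H-> ->].
- by move=> p o f e g l [e' h|h] /closed_estep.
- move=> p q x e s g l [e' h|h] /closed_estep//= H.
  by rewrite /closed_stmt /= !cat_nilp => /and3P[-> /H-> ->].
- by move=> p s g l [].
- by move=> p s t g l k _ IH _; rewrite closed_Seq => /andP[/IH ck ct];
    apply: closed_andthen => // s' cs'; rewrite closed_Seq cs'.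
- by move=> p s t g l k _ IH _; rewrite closed_Seq => /andP[/IH].
- by move=> p s t g l k _ _ IH; rewrite closed_Seq => /andP[ct /IH ck];
    apply: closed_andthen => // s' cs'; rewrite closed_Seq ct.
- move=> p q x v s g v' g' _ /andP[/andP[cs fs] _].
  by rewrite /closed_stmt /= cats0 andbT; apply: closed_ssubst.
- by move=> p q s g l [].
- by move=> p s t g l k _ IH _; rewrite closed_Try => /andP[/IH ck ct];
    apply: closed_plug => // s' cs'; rewrite closed_Try cs'.
- by move=> p s t g l k _ IH _; rewrite closed_Try => /andP[/IH ck ct];
    apply: closed_andthen => // s' cs'; rewrite closed_Seq cs'.
Qed.

Lemma isAsync_notSync s : isAsync s -> ~~ isSync s.
Proof.
by elim: s => //= s IHs t IHt /andP[/IHs/negbTE-> /IHt].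
Qed.

(** Every step of an asynchronous statement takes place beneath some [DynAsync], where [async_label]
    turns synchronous exceptions into asynchronous ones; the enclosing contexts then pass the label
    on. *)
Lemma isAsync_step p k l k' : step home p k l k' ->
  (if k is Run s _ then isAsync s else true) ->
  ~~ is_syncexn l /\ (if k' is Run s _ then isAsync s else true).
Proof.
elim=> {p k l k'} //=.
- by move=> p s g l [s' g'|g'] _ _ _; case: l.
- move=> p s t g l [s' g'|g'] _ IH _ /andP[/IH[nl ak] at_] //=.
  by rewrite ak.
(* Rule [s_seq_exn], which would discard [t], cannot fire: the induction hypothesis excludes its
   label. The same holds for [s_try_exn] below. *)
- by move=> p s t g l k _ IH ln /andP[/IH[]]; rewrite ln.
- move=> p s t g l [s' g'|g'] at_ _ IH /andP[_ /IH[nl ak]] //=.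
  by rewrite at_.
- by move=> p q s g l [s' g'|g'] _ IH /IH.
- by move=> p s t g l [s' g'|g'] _ IH _ /IH.
- by move=> p s t g l k _ IH ln /IH[]; rewrite ln.
Qed.

Lemma wstep_step p k l k' : step home p k l k' -> wstep home p k l k'.
Proof.
case: l => [|v|v] st; first exact: rt_step.
all: by exists k, k'; split=> //; apply: rt_refl.
Qed.

(** The heap is arbitrary in both constructors, so the relation is stable under environment moves.
    The diagonal takes over once a component has terminated, from where any closed statement may
    follow. *)
Inductive seq_swap : sconf n -> sconf n -> Prop :=
  | seq_swap_refl k : closed_conf k -> seq_swap k k
  | seq_swap_seq s t g :
      closed_stmt s -> closed_stmt t -> isAsync s -> isAsync t ->
      seq_swap (Run (Seq s t) g) (Run (Seq t s) g).

Lemma seq_swap_closed k k' : seq_swap k k' -> closed_conf k /\ closed_conf k'.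
Proof. by case=> //= s t g cs ct _ _; rewrite !closed_Seq cs ct. Qed.

Lemma seq_swap_sym k k' : seq_swap k k' -> seq_swap k' k.
Proof. by case=> [k0|s t g]; constructor. Qed.

(** The conclusion also forces [k] to be a [Run]: when one component terminates the other remains.
    This rules out immediate termination in the bisimulation clauses. *)
Lemma seq_swap_step p s t g l k :
  closed_stmt s -> closed_stmt t -> isAsync s -> isAsync t ->
  step home p (Run (Seq s t) g) l k ->
  exists s' g' t', [/\ k = Run s' g',
    step home p (Run (Seq t s) g) l (Run t' g') &
    seq_swap (Run s' g') (Run t' g')].
Proof.
move=> cs ct as_ at_ st.
(* Only [s_seq], [s_seq_exn] and [s_par] apply to a [Seq]. *)
inversion st as [| | | | | | | | | | | | |p1 s1 t1 g1 l1 k1 st1 nl|p1 s1 t1 g1 l1 k1 st1 ln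
                |p1 s1 t1 g1 l1 k1 _ st1| | | |]; subst.
- have [_ ak] := isAsync_step st1 as_; have ck := closed_step st1 cs.
  have st2 := s_par at_ st1.
  case: k1 {st st1} ak ck st2 => [s' g'|g'] /= ak ck st2.
    by exists (Seq s' t), g', (Seq t s'); split=> //; apply: seq_swap_seq.
  by exists t, g', t; split=> //; apply: seq_swap_refl.
- by have [] := isAsync_step st1 as_; rewrite ln.
(* Answering by [s_seq] requires a label that is no synchronous exception; asynchrony of [t]
   supplies this as [nl]. *)
- have [nl ak] := isAsync_step st1 at_; have ck := closed_step st1 ct.
  have st2 := s_seq s st1 nl.
  case: k1 {st st1} ak ck st2 => [t' g'|g'] /= ak ck st2.
    by exists (Seq s t'), g', (Seq t' s); split=> //; apply: seq_swap_seq.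
  by exists s, g', s; split=> //; apply: seq_swap_refl.
Qed.

Lemma seq_swap_bisimulation : weak_bisimulation home seq_swap.
Proof.
split; first exact: seq_swap_closed.
  by move=> g k Rk; inversion Rk.
move=> s0 g k Rk; inversion Rk as [k0 cs|s t g0 cs ct as_ at_]; subst.
  exists s0; split=> // Phi p _; split=> [l s' g' st|l s' g' st|l g'|l g'];
    try exact: wstep_step.
  - by exists s'; split; [apply: wstep_step | apply: seq_swap_refl; apply: closed_step st _].
  - by exists s'; split; [apply: wstep_step | apply: seq_swap_refl; apply: closed_step st _].
exists (Seq t s); split=> //=.
  (* [isSync] is false on both orders, as it is false on both components. *)
  by rewrite (negbTE (isAsync_notSync as_)) (negbTE (isAsync_notSync at_)).
move=> Phi p _; split=> [l s' g' st|l s' g' st|l g' st|l g' st].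
- have [u [h [t' [[-> ->] st' R]]]] := seq_swap_step cs ct as_ at_ st.
  by exists t'; split=> //; apply: wstep_step.
- have [u [h [t' [[-> ->] st' R]]]] := seq_swap_step ct cs at_ as_ st.
  by exists t'; split; [apply: wstep_step | apply: seq_swap_sym].
(* The equation between [Done g'] and a [Run] is absurd. *)
- by have [u [h [t' []]]] := seq_swap_step cs ct as_ at_ st.
- by have [u [h [t' []]]] := seq_swap_step ct cs at_ as_ st.
Qed.

End Steps.

Theorem mainTheorem18 (n : nat) (home : objId -> 'I_n) (s t : stmt n)
    (g : gheap n) :
  closed_stmt s -> closed_stmt t -> isAsync s -> isAsync t ->
  weakly_bisimilar home (Run (Seq s t) g) (Run (Seq t s) g).
Proof.
move=> cs ct as_ at_; exists (@seq_swap n); first exact: seq_swap_bisimulation.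
exact: seq_swap_seq.
Qed.
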